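(* Let $\mathcal{A}=\{H_1,\dots,H_m\}$ be a linear hyperplane arrangement in $\mathbb{R}^n$ and let $0\le k\le n$. For any two subspaces $U_1,U_2\in\mathrm{Gr}(k,n)$ the following are equivalent: (a) $U_1$ and $U_2$ lie in the same $\mathcal{A}$-matroid stratum, i.e. $\mathfrak{M}_{\mathcal{A}}(U_1)=\mathfrak{M}_{\mathcal{A}}(U_2)$; (b) $U_1$ and $U_2$ lie in the same $\mathcal{A}$-adjoint stratum $\mathcal{S}_{i,P}$ (for some $i\in\{0,\dots,k\}$ and some $P\in L(\mathcal{A}^{(k-i)})$); (c) $U_1$ and $U_2$ lie in the same refined $\mathcal{A}$-Schubert stratum $\Omega_{\mathcal{A}}(i,\sigma_i)$ (for some $i\in\{0,\dots,k\}$ and some $i$-Schubert symbol $\sigma_i$). In other words, the $\mathcal{A}$-matroid decomposition, the $\mathcal{A}$-adjoint decomposition and the refined $\mathcal{A}$-Schubert decomposition of $\mathrm{Gr}(k,n)$ have exactly the same nonempty strata.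
   Context: $\mathcal{A}=\{H_i=\{v\in\mathbb{R}^n:\langle\alpha_i,v\rangle=0\}: i=1,\dots,m\}$ with nonzero $\alpha_i\in\mathbb{R}^n$, $\langle\cdot,\cdot\rangle$ the standard inner product. $T:=\bigcap_{i=1}^m H_i$. The intersection lattice $L(\mathcal{A})$ is the set of all intersections of subfamilies of $\mathcal{A}$ (including $\mathbb{R}^n$ as the empty intersection), ordered by reverse inclusion, with rank $\operatorname{rk}(X)=n-\dim X$; $r:=\operatorname{rk}(T)$, and $L_k(\mathcal{A})$ is the set of $X\in L(\mathcal{A})$ with $\operatorname{rk}(X)=k$. $\mathrm{Gr}(k,n)$ is the set of $k$-dimensional subspaces of $\mathbb{R}^n$. Plücker coordinates: for a $d$-dimensional subspace $W$ with a $d\times n$ matrix $A$ whose rows form a basis of $W$, $\Delta(W)=(\Delta_I(W))_{I\in\binom{[n]}{d}}\in\mathbb{R}^{\binom{[n]}{d}}$ where $\Delta_I(W)$ is the $d\times d$ minor of $A$ on columns $I$; it is defined up to a nonzero scalar. Adjoint arrangements: for $X\in L_k(\mathcal{A})$ and $I\in\binom{[n]}{k}$ put $a_I(X)=(-1)^{k(k+1)/2+\sum_{i\in I}i}\Delta_{[n]\setminus I}(X)$, and $H(X)=\{(x_I)\in\mathbb{R}^{\binom{[n]}{k}}:\sum_I a_I(X)x_I=0\}$. The $k$-adjoint is $\mathcal{A}^{(k)}=\{H(X):X\in L_k(\mathcal{A})\}$, an arrangement in $\mathbb{R}^{\binom{[n]}{k}}$ ($\mathcal{A}^{(n)}$ is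 empty if $k=n$ exceeds $r$, etc.). For an arrangement $\mathcal{B}$ and $P\in L(\mathcal{B})$, the relative interior is $P^\circ=P\setminus\bigcup_{Q\in L(\mathcal{B}),\,Q\subsetneq P}Q$. $\mathcal{A}$-matroid: for a subspace $U$, let $\beta_i$ be the orthogonal projection of $\alpha_i$ onto $U$; $\mathfrak{M}_{\mathcal{A}}(U)$ is the matroid on $[m]$ with rank function $\operatorname{rk}(I)=\dim\operatorname{span}\{\beta_i:i\in I\}$. $\mathbf{M}(\mathcal{A})=\{\mathfrak{M}_{\mathcal{A}}(U):U\in\mathrm{Gr}(k,n)\}$ and $\Omega_{\mathcal{A}}(\mathfrak{M})=\{U\in\mathrm{Gr}(k,n):\mathfrak{M}_{\mathcal{A}}(U)=\mathfrak{M}\}$. $\mathcal{A}$-adjoint stratum: for $i\in\{0,\dots,k\}$ and $P\in L(\mathcal{A}^{(k-i)})$, $\mathcal{S}_{i,P}=\{U\in\mathrm{Gr}(k,n): \dim(U\cap T)=i,\ \Delta(U\cap(U^\perp+T^\perp))\in P^\circ\}$. Refined $\mathcal{A}$-Schubert strata: for a maximal chain $\boldsymbol{F}: T=F_0\subsetneq F_1\subsetneq\cdots\subsetneq F_r=\mathbb{R}^n$ of $L(\mathcal{A})$ (so $\dim F_j=n-r+j$), $i\in\{0,\dots,k\}$ and $\sigma=\{i_1<\dots<i_{k-i}\}\subseteq[r]$, let $\Omega_{\boldsymbol{F}}(i,\sigma)=\{U\in\mathrm{Gr}(k,n):\dim(U\cap T)=i,\ \dim(U\cap F_{i_l})>\dim(U\cap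 F_{i_l-1})\text{ for }1\le l\le k-i\}$. With $\mathbf{mc}(L(\mathcal{A}))$ the set of maximal chains, an $i$-Schubert symbol is a map $\sigma_i:\mathbf{mc}(L(\mathcal{A}))\to\binom{[r]}{k-i}$ with $\Omega_{\mathcal{A}}(i,\sigma_i):=\bigcap_{\boldsymbol{F}}\Omega_{\boldsymbol{F}}(i,\sigma_i(\boldsymbol{F}))\neq\emptyset$. *)

(* Defs.v *)
(* Subspaces of R^n are represented by square matrices
   'M[R]_n through their row spaces (mxalgebra, scope %MS). *)
From HB Require Import structures.
From mathcomp Require Import all_boot all_order all_algebra.
From mathcomp Require Import reals.
Set Implicit Arguments. Unset Strict Implicit. Unset Printing Implicit Defensive.
Import Order.TTheory GRing.Theory Num.Theory.
Local Open Scope ring_scope.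

Section Defs.
Variables (R : realType) (n m : nat) (alpha : 'I_m -> 'rV[R]_n).

Definition orthc (U : 'M[R]_n) : 'M[R]_n := kermx U^T.

Definition hypl (i : 'I_m) : 'M[R]_n := kermx (alpha i)^T.

(* intersection of the subfamily {H_i : i in J}; X_J for J = set0 is R^n *)
Definition flatJ (J : {set 'I_m}) : 'M[R]_n := (\bigcap_(i in J) hypl i)%MS.

Definition in_lattice (X : 'M[R]_n) : Prop := exists J : {set 'I_m}, (X == flatJ J)%MS.

Definition Tcap : 'M[R]_n := flatJ setT.
Definition rkT : nat := (n - \rank Tcap)%N.

Definition oproj (U : 'M[R]_n) : 'M[R]_n := proj_mx U (orthc U).
Definition beta (U : 'M[R]_n) (i : 'I_m) : 'rV[R]_n := alpha i *m oproj U.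
Definition amatroid_rank (U : 'M[R]_n) (J : {set 'I_m}) : nat :=
  \rank (\sum_(i in J) <<beta U i>>)%MS.

(* the minor of B (p x n) on the columns in I (listed increasingly) *)
Definition minor p (B : 'M[R]_(p, n)) (I : {set 'I_n}) : R :=
  \det (\matrix_(a < p, b < p)
          \sum_(x : 'I_n | val x == nth 0%N [seq val y | y <- enum I] b) B a x).
Definition plucker (W : 'M[R]_n) (I : {set 'I_n}) : R := minor (row_base W) I.

Definition ksub (d : nat) := {I : {set 'I_n} | #|I| == d}.

(* the coefficient a_I(X) (indices of [n] are 1-based in the paper) *)
Definition adj_coef (d : nat) (X : 'M[R]_n) (I : ksub d) : R :=
  (-1) ^+ ((d * d.+1) %/ 2 + \sum_(i in val I) (val i).+1)%N
    * plucker X (~: val I).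

(* the d-adjoint arrangement A^(d) consists of the hyperplanes H(X_J),
   X_J in L_d(A).  A subfamily is given by a set of index sets J;
   Zset d JJ is the intersection of the hyperplanes H(X_J), J in JJ with
   rk X_J = d (an element of L(A^(d))). *)
Definition Zset (d : nat) (JJ : {set {set 'I_m}}) (x : ksub d -> R) : Prop :=
  forall J, J \in JJ -> (n - \rank (flatJ J))%N = d ->
    \sum_(I : ksub d) adj_coef (flatJ J) I * x I = 0.

Definition in_relint (d : nat) (JJ : {set {set 'I_m}}) (x : ksub d -> R) : Prop :=
  Zset JJ x /\
  forall JJ' : {set {set 'I_m}},
    (forall y : ksub d -> R, Zset JJ' y -> Zset JJ y) ->
    (exists y : ksub d -> R, Zset JJ y /\ ~ Zset JJ' y) ->
    ~ Zset JJ' x.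

Definition adj_stratum (k i : nat) (JJ : {set {set 'I_m}}) (U : 'M[R]_n) : Prop :=
  \rank U = k /\ \rank (U :&: Tcap)%MS = i /\
  in_relint JJ
    (fun I : ksub (k - i) =>
       plucker (U :&: (orthc U + orthc Tcap))%MS (val I)).

Definition max_chain (F : nat -> 'M[R]_n) : Prop :=
  (forall j, (j <= rkT)%N -> in_lattice (F j)) /\
  (F 0%N == Tcap)%MS /\ (F rkT == 1%:M)%MS /\
  (forall j, (j < rkT)%N -> (F j < F j.+1)%MS).

(* Omega_F(i, sigma), sigma subset of [r] written 0-based:
   j in s  stands for  i_l = j+1 *)
Definition schubF (k i : nat) (F : nat -> 'M[R]_n) (s : {set 'I_rkT})
    (U : 'M[R]_n) : Prop :=
  \rank U = k /\ \rank (U :&: Tcap)%MS = i /\ #|s| = (k - i)%N /\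
  forall j : 'I_rkT, j \in s ->
    (\rank (U :&: F j) < \rank (U :&: F j.+1))%N.

Definition schub_stratum (k i : nat) (sigma : (nat -> 'M[R]_n) -> {set 'I_rkT})
    (U : 'M[R]_n) : Prop :=
  \rank U = k /\ \rank (U :&: Tcap)%MS = i /\
  forall F, max_chain F -> schubF k i F (sigma F) U.

End Defs.

Arguments schub_stratum [R n m] alpha k i sigma U.
Arguments schubF [R n m] alpha k i F s U.
Arguments max_chain [R n m] alpha F.
Arguments rkT [R n m] alpha.
Arguments Tcap [R n m] alpha.

(* Main.v *)
(* Write [X_J] for the flat cut out by the hyperplanes indexed by [J].  The rank
   of [J] in the A-matroid of [U] is [dim U - dim (U :&: X_J)], so each
   decomposition only has to be shown to record the numbers [dim (U :&: X_J)].

   Schubert strata: along a maximal chain the dimension of [U :&: F_j] grows by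
   0 or 1, so it is determined by the positions of the jumps, and every flat
   lies on a maximal chain.

   Adjoint strata: [W := U :&: (U^perp + T^perp)] is the orthogonal complement
   of [U :&: T] in [U].  By Laplace expansion along complementary rows, the
   linear form defining [H(X)] takes at the Plucker vector of [W] the value
   [det (W over X)], which vanishes iff [W :&: X != 0], i.e. iff
   [dim (U :&: X) != i].  The flats of corank [k - i] with [dim (U :&: X) = i]
   record exactly the bases of the matroid, and these determine its rank. *)
Require Import Defs.
From HB Require Import structures.
From mathcomp Require Import all_boot all_order all_algebra all_fingroup.
From mathcomp Require Import reals.
From mathcomp Require Import zify.
Import Order.TTheory GRing.Theory Num.Theory.
Local Open Scope ring_scope.
Set Implicit Arguments. Unset Strict Implicit. Unset Printing Implicit Defensive.

(** * Orthogonal complements *)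

Section Ortho.
Variables (R : realType) (n : nat).
Implicit Types U V T X : 'M[R]_n.

Lemma sub_orthcP p (v : 'M[R]_(p, n)) U : reflect (v *m U^T = 0) (v <= orthc U)%MS.
Proof. exact: sub_kermxP. Qed.

(** The diagonal entries of [v *m v^T] are sums of squares of reals. This positivity is what makes
    [orthc U] meet [U] trivially. *)
Lemma mulmx_tr_eq0 p (v : 'M[R]_(p, n)) : v *m v^T = 0 -> v = 0.
Proof.
move=> v0; apply/matrixP=> i j; rewrite mxE.
have: (v *m v^T) i i = 0 by rewrite v0 mxE.
rewrite mxE => /eqP; rewrite psumr_eq0 => [/allP /(_ j)|l _]; last first.
  by rewrite mxE -expr2 sqr_ge0.
by rewrite mem_index_enum mxE mulf_eq0 orbb => /(_ isT) /eqP.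
Qed.

Lemma cap_orthc U : (U :&: orthc U)%MS = 0.
Proof.
apply: mulmx_tr_eq0; set v := (_ :&: _)%MS.
have /submxP [w {2}->] : (v <= U)%MS by exact: capmxSl.
have /sub_orthcP v0 : (v <= orthc U)%MS by exact: capmxSr.
by rewrite trmx_mul mulmxA v0 mul0mx.
Qed.

Lemma sub_orthcC U V : (U <= orthc V)%MS = (V <= orthc U)%MS.
Proof.
by apply/sub_orthcP/sub_orthcP => /(congr1 trmx); rewrite trmx_mul trmxK trmx0.
Qed.

Lemma mxrank_orthc U : \rank (orthc U) = (n - \rank U)%N.
Proof. by rewrite mxrank_ker mxrank_tr. Qed.

Lemma orthcK U : (orthc (orthc U) :=: U)%MS.
Proof.
apply/eqmx_sym/eqmxP; rewrite -(geq_leqif (mxrank_leqif_eq _)).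
  by rewrite !mxrank_orthc subKn ?rank_leq_row.
by rewrite sub_orthcC.
Qed.

Lemma add_orthc U : (U + orthc U == 1%:M)%MS.
Proof.
rewrite -(geq_leqif (mxrank_leqif_eq (submx1 _))) mxrank1.
rewrite mxrank_disjoint_sum ?cap_orthc // mxrank_orthc subnKC //.
exact: rank_leq_row.
Qed.

Lemma kermx_oproj U : (kermx (oproj U) :=: orthc U)%MS.
Proof.
apply/eqmxP/andP; split.
  set v := kermx _.
  have v1 : (v <= U + orthc U)%MS by rewrite (eqmxP (add_orthc U)) submx1.
  rewrite -(add_proj_mx (cap_orthc U) v1) -/(oproj U) mulmx_ker add0r.
  exact: proj_mx_sub.
by apply/sub_kermxP/proj_mx_0; rewrite ?cap_orthc.
Qed.

Lemma mxrank_mul_eqker p q r (A : 'M[R]_(p, n)) (B : 'M_(n, q)) (C : 'M_(n, r)) :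
  (kermx B :=: kermx C)%MS -> \rank (A *m B) = \rank (A *m C).
Proof.
move=> eqk; apply: (@addIn (\rank (A :&: kermx B))).
by rewrite mxrank_mul_ker (cap_eqmx (eqmx_refl A) eqk) mxrank_mul_ker.
Qed.

(** The matrices [oproj U] and [U^T] share the left kernel [orthc U], so one may replace the other.
    Transposing [A *m U^T] then lets rank-nullity act on [U]. *)
Lemma mxrank_mul_oproj U p (A : 'M[R]_(p, n)) :
  \rank (A *m oproj U) = (\rank U - \rank (U :&: kermx A^T))%N.
Proof.
rewrite (mxrank_mul_eqker A (kermx_oproj U)) -mxrank_tr trmx_mul trmxK.
by rewrite -(mxrank_mul_ker U A^T) addnK.
Qed.

(** By biduality [U :&: T] is orthogonal to both summands, hence to their sum, and a space meets its
    orthogonal complement trivially. *)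
Lemma cap_add_orthc U T :
  (U :&: T :&: (orthc U + orthc T) = 0)%MS.
Proof.
set V := (orthc U + orthc T)%MS.
apply/eqP; rewrite -submx0 -(cap_orthc V) capmxC capmxS // sub_orthcC.
by rewrite addsmx_sub -!(sub_orthcC (U :&: T)%MS) !orthcK capmxSl capmxSr.
Qed.

Lemma orthcS U V : (U <= V)%MS -> (orthc V <= orthc U)%MS.
Proof.
by move=> sUV; rewrite sub_orthcC; apply: submx_trans sUV _; rewrite sub_orthcC.
Qed.

Lemma mxrank_add_orthc U T :
  (n - \rank (U :&: T)%MS <= \rank (orthc U + orthc T)%MS)%N.
Proof.
set V := (_ + _)%MS.
have oV : (orthc V <= U :&: T)%MS.
  rewrite sub_capmx; apply/andP; split.
    by rewrite -(orthcK U); apply/orthcS/addsmxSl.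
  by rewrite -(orthcK T); apply/orthcS/addsmxSr.
have := mxrankS oV; rewrite mxrank_orthc; have := rank_leq_row V; lia.
Qed.

(* [U :&: (orthc U + orthc T)] is the orthogonal complement of [U :&: T] in
   [U], so the modular law splits [U :&: X] whenever [T] lies below [X]. *)
Lemma mxrank_cap_split U T X : (T <= X)%MS ->
  \rank (U :&: X)%MS =
    (\rank (U :&: T)%MS + \rank ((U :&: (orthc U + orthc T)) :&: X)%MS)%N.
Proof.
move=> sTX; set V := (orthc U + orthc T)%MS; set Y := (U :&: T)%MS.
set W := (U :&: V)%MS.
have YW0 : (Y :&: W = 0)%MS.
  apply/eqP; rewrite -submx0 -(cap_add_orthc U T) capmxS //; exact: capmxSr.
have sYWU : (Y + W <= U)%MS by rewrite addsmx_sub !capmxSl.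
(* Dimension count: [\rank W] is at least [\rank U + \rank V - n], and [\rank V] is at least
   [n - \rank Y]. *)
have eYWU : (Y + W :=: U)%MS.
  apply/eqmxP; rewrite -(geq_leqif (mxrank_leqif_eq sYWU)).
  rewrite mxrank_disjoint_sum //.
  have := mxrank_sum_cap U V; rewrite -/W.
  have := mxrank_add_orthc U T; rewrite -/Y -/V.
  have := rank_leq_row (U + V)%MS; have := rank_leq_row V.
  have := rank_leq_row Y; lia.
have sYX : (Y <= X)%MS by apply: submx_trans (capmxSr _ _) sTX.
rewrite -(cap_eqmx eYWU (eqmx_refl X)) -(matrix_modl W sYX) mxrank_disjoint_sum //.
by apply/eqP; rewrite -submx0 -YW0 capmxS // capmxSl.
Qed.

Lemma mxrank_orthc_in U T :
  \rank (U :&: (orthc U + orthc T))%MS = (\rank U - \rank (U :&: T)%MS)%N.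
Proof.
have := mxrank_cap_split U (submx1 T).
by rewrite !capmx1 => ->; rewrite addKn.
Qed.

End Ortho.

(** * Matroid of a vector family *)

Section Matroid.
Variables (F : fieldType) (n m : nat) (v : 'I_m -> 'rV[F]_n).
Implicit Types I J B : {set 'I_m}.

(** Used for two families: [beta alpha U] gives the A-matroid of [U], and [alpha] gives the coranks
    of the flats. *)
Definition rksum J := \rank (\sum_(i in J) <<v i>>)%MS.

Lemma rksumS I J : I \subset J -> (rksum I <= rksum J)%N.
Proof.
move=> /subsetP sIJ; apply: mxrankS; apply/sumsmx_subP => i iI.
exact: (sumsmx_sup i) (sIJ _ iI) _.
Qed.

Lemma rksumU1 j J : (rksum (j |: J) <= (rksum J).+1)%N.
Proof.
have s : (\sum_(i in j |: J) <<v i>> <= \sum_(i in J) <<v i>> + <<v j>>)%MS.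
  apply/sumsmx_subP => i; rewrite in_setU1 => /orP[/eqP->|iJ]; first exact: addsmxSr.
  by apply: submx_trans (addsmxSl _ _); apply: (sumsmx_sup i).
apply: leq_trans (mxrankS s) _; apply: leq_trans (mxrank_adds_leqif _ _) _.
by rewrite -[X in (_ <= X)%N]addn1 leq_add2l genmxE rank_leq_row.
Qed.

Lemma rksum_setU I J : (rksum (I :|: J) <= rksum I + #|J|)%N.
Proof.
move eqd: #|J| => d; elim: d J eqd => [|d IH] J eqd.
  by move/eqP: eqd; rewrite cards_eq0 => /eqP ->; rewrite setU0 addn0.
have [j jJ] : exists j, j \in J by apply/set0Pn; rewrite -cards_eq0 eqd.
rewrite -(setD1K jJ) setUCA addnS; apply: leq_trans (rksumU1 _ _) _.
by rewrite ltnS IH //; rewrite (cardsD1 j J) jJ in eqd; case: eqd.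
Qed.

Lemma rksum0 : rksum set0 = 0%N.
Proof. by rewrite /rksum big_set0 mxrank0. Qed.

Lemma rksum_card J : (rksum J <= #|J|)%N.
Proof. by have := rksum_setU set0 J; rewrite set0U rksum0. Qed.

(** Adding [B :\: I] raises the rank by at most its cardinality, so a deficit in [I] would persist
    in [B]. *)
Lemma rksum_free_sub I B : I \subset B -> rksum B = #|B| -> rksum I = #|I|.
Proof.
move=> sIB eB; apply/eqP; rewrite eqn_leq rksum_card /=.
have := rksum_setU I (B :\: I); rewrite -{1}(setIidPr sIB) setID eB.
by rewrite -(cardsID I B) (setIidPr sIB) leq_add2r.
Qed.

(** A maximal independent set between [I] and [J] spans: a vector of [J] outside its span could be
    added to it. *)
Lemma rksum_extend I J : I \subset J -> rksum I = #|I| ->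
  exists B, [/\ I \subset B, B \subset J, rksum B = #|B| & rksum B = rksum J].
Proof.
move=> sIJ fI; pose P B := [&& I \subset B, B \subset J & rksum B == #|B|].
have PI : P I by rewrite /P subxx sIJ fI eqxx.
have [B /maxsetP [/and3P [sIB sBJ /eqP fB] maxB] _] := maxset_exists PI.
exists B; split=> //; apply/eqP; rewrite eqn_leq rksumS //=.
apply: mxrankS; apply/sumsmx_subP => j jJ.
have [jB|jB] := boolP (j \in B); first exact: (sumsmx_sup j).
have jU : ~~ P (j |: B).
  by apply: contra jB => /maxB <-; rewrite ?setU11 ?subsetUr.
have rU : (rksum (j |: B) <= rksum B)%N.
  have := rksumU1 j B; rewrite leq_eqVlt ltnS => /orP[/eqP e|//].
  case/negP: jU; rewrite /P (subset_trans sIB) ?subsetUr //= subUset sub1set jJ sBJ /=.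
  by rewrite e fB cardsU1 jB.
have sBU : (\sum_(i in B) <<v i>> <= \sum_(i in j |: B) <<v i>>)%MS.
  apply/sumsmx_subP => i iB; rewrite (sumsmx_sup i) // in_setU1 iB orbT //.
have := geq_leqif (mxrank_leqif_sup sBU); rewrite -/(rksum _) rU => /esym.
by apply: submx_trans; rewrite (sumsmx_sup j) // setU11.
Qed.
End Matroid.

(** A maximal independent subset [I] of [J] extends to a basis [B] of the first matroid. As [B] is
    independent in the second, so is [I], which bounds the second rank of [J] from below. *)
Lemma rksum_bases (F : fieldType) (m n1 n2 : nat) (v1 : 'I_m -> 'rV[F]_n1)
  (v2 : 'I_m -> 'rV[F]_n2) :
  (forall B, rksum v1 B = #|B| -> rksum v1 B = rksum v1 setT -> rksum v2 B = #|B|) ->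
  forall J, (rksum v1 J <= rksum v2 J)%N.
Proof.
move=> h J.
have [|I [_ sIJ fI eI]] := rksum_extend (sub0set J) (v := v1).
  by rewrite rksum0 cards0.
have [B [sIB _ fB eB]] := rksum_extend (subsetT I) fI.
by rewrite -eI fI -(rksum_free_sub sIB (h B fB eB)) rksumS.
Qed.

(** * Flats of the arrangement *)

Section Flats.
Variables (R : realType) (n m : nat) (alpha : 'I_m -> 'rV[R]_n).
Implicit Types (J : {set 'I_m}) (U : 'M[R]_n).

Lemma sub_flatJP p (v : 'M[R]_(p, n)) J :
  reflect (forall i, i \in J -> v *m (alpha i)^T = 0) (v <= flatJ alpha J)%MS.
Proof.
apply: (iffP sub_bigcapmxP) => h i iJ; first exact/sub_kermxP/h.
exact/sub_kermxP/h.
Qed.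

Lemma flatJ_kermx J : (flatJ alpha J :=: kermx (\sum_(i in J) <<alpha i>>)%MS^T)%MS.
Proof.
apply/eqmxP/andP; split.
  apply/sub_orthcP/trmx_inj; rewrite trmx_mul trmxK trmx0; apply/sub_orthcP.
  apply/sumsmx_subP => i iJ; rewrite genmxE; apply/sub_orthcP.
  apply: trmx_inj; rewrite trmx_mul trmxK trmx0.
  by move/sub_flatJP: (submx_refl (flatJ alpha J)); apply.
apply/sub_flatJP => i iJ.
have /submxP [w ->] : (alpha i <= \sum_(i in J) <<alpha i>>)%MS.
  by rewrite (sumsmx_sup i) ?genmxE.
by rewrite trmx_mul mulmxA mulmx_ker mul0mx.
Qed.

(** The span of the [beta U i] is the image under [oproj U] of the span of the [alpha i], whose
    orthogonal complement is the flat. *)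
Lemma amatroid_rankE U J :
  amatroid_rank alpha U J = (\rank U - \rank (U :&: flatJ alpha J)%MS)%N.
Proof.
rewrite /amatroid_rank (cap_eqmx (eqmx_refl U) (flatJ_kermx J)) -mxrank_mul_oproj.
rewrite (sumsmxMr_gen _ _ (oproj U)); apply/eqmx_rank/eqmxP.
apply: eqmx_sums => i _; apply: eqmx_trans (genmxE _) _.
apply: eqmx_sym; apply: eqmx_trans (genmxE _) _.
exact/eqmxMr/genmxE.
Qed.

Lemma flatJS (J K : {set 'I_m}) : J \subset K -> (flatJ alpha K <= flatJ alpha J)%MS.
Proof.
move=> /subsetP sJK; apply/sub_flatJP => i iJ.
by move/sub_flatJP: (submx_refl (flatJ alpha K)); apply; apply: sJK.
Qed.

Lemma sub_Tcap_flatJ J : (Tcap alpha <= flatJ alpha J)%MS.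
Proof. exact/flatJS/subsetT. Qed.

Lemma flatJU1 (J : {set 'I_m}) j :
  (flatJ alpha (j |: J) :=: flatJ alpha J :&: kermx (alpha j)^T)%MS.
Proof.
apply/eqmxP/andP; split.
  rewrite sub_capmx flatJS ?subsetUr //=; apply/sub_kermxP.
  by move/sub_flatJP: (submx_refl (flatJ alpha (j |: J))); apply; rewrite setU11.
apply/sub_flatJP => i; rewrite in_setU1 => /orP[/eqP->|iJ].
  by apply/sub_kermxP; apply: capmxSr.
by move: i iJ; apply/sub_flatJP; apply: capmxSl.
Qed.

Lemma mxrank_flatJU1 J j :
  (\rank (flatJ alpha J) <= (\rank (flatJ alpha (j |: J))).+1)%N.
Proof.
have := mxrank_mul_ker (flatJ alpha J) (alpha j)^T.
have := rank_leq_col (flatJ alpha J *m (alpha j)^T).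
by rewrite flatJU1 => r1 <-; apply: (leq_add r1 (leqnn _)).
Qed.

Lemma corank_flatJ J : (n - \rank (flatJ alpha J) = rksum alpha J)%N.
Proof. by rewrite flatJ_kermx mxrank_ker mxrank_tr subKn ?rank_leq_row. Qed.

End Flats.

(** * Generalized Laplace expansion *)

Section Shuffle.
Variable n : nat.
Implicit Types I : {set 'I_n}.

Definition shuffle_seq I : seq 'I_n := enum I ++ enum (~: I).

Lemma shuffle_seq_uniq I : uniq (shuffle_seq I).
Proof.
rewrite cat_uniq !enum_uniq andbT; apply/hasPn => x.
by rewrite !mem_enum in_setC.
Qed.

Lemma size_shuffle_seq I : size (shuffle_seq I) = n.
Proof. by rewrite size_cat -!cardE cardsC card_ord. Qed.

Lemma shuffle_fun_inj I : injective (fun i : 'I_n => nth i (shuffle_seq I) i).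
Proof.
move=> i j /=; rewrite (set_nth_default i j) ?size_shuffle_seq // => /eqP.
by rewrite nth_uniq ?size_shuffle_seq ?shuffle_seq_uniq // => /eqP/val_inj.
Qed.

(* Lists [I] in increasing order, then the complement of [I]. *)
Definition shuffle I : {perm 'I_n} := perm (@shuffle_fun_inj I).

Lemma shuffleE I (i0 i : 'I_n) : shuffle I i = nth i0 (shuffle_seq I) i.
Proof. by rewrite permE; apply: set_nth_default; rewrite size_shuffle_seq. Qed.

Lemma sorted_enum_ord I : sorted (relpre val ltn) (enum I).
Proof.
rewrite {1}/enum_mem -enumT; apply: sorted_filter.
  by move=> y x z /=; apply: ltn_trans.
by rewrite -sorted_map val_enum_ord iota_ltn_sorted.
Qed.

Lemma enum_ord_eq I (s : seq 'I_n) :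
  sorted (relpre val ltn) s -> s =i I -> s = enum I.
Proof.
move=> ss sI; apply: (irr_sorted_eq _ _ ss (sorted_enum_ord I)).
- by move=> y x z /=; apply: ltn_trans.
- by move=> x /=; apply: ltnn.
by move=> x; rewrite sI mem_enum.
Qed.

(** Swapping two adjacent values reverses the order of no pair except [x], [y] itself, so the mapped
    list stays sorted. *)
Lemma enum_imset_tperm I (x y : 'I_n) : y = x.+1 :> nat ->
  ~~ ((x \in I) && (y \in I)) -> enum (tperm x y @: I) = map (tperm x y) (enum I).
Proof.
move=> xy nI; symmetry; apply: enum_ord_eq; last first.
  move=> z; rewrite -[z in LHS](tpermK x y) -[z in RHS](tpermK x y).
  by rewrite (mem_map perm_inj) mem_enum mem_imset //; apply: perm_inj.
apply: (homo_sorted_in (P := mem I)) (sorted_enum_ord I); last first.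
  by apply/allP => z; rewrite mem_enum.
move=> a b aI bI /= ab; have aIb : a \in I by []; have bIb : b \in I by [].
case: (tpermP x y a) => [ea|ea|ax ay]; case: (tpermP x y b) => [eb|eb|bx b_y];
  rewrite ?ea ?eb in ab aIb bIb *; rewrite ?aIb ?bIb // in nI; try lia.
- have : b <> y :> nat by move/val_inj. by lia.
- have : a <> x :> nat by move/val_inj. by lia.
Qed.

Lemma shuffle_tperm I (x y : 'I_n) : y = x.+1 :> nat -> x \notin I -> y \in I ->
  shuffle (tperm x y @: I) = (shuffle I * tperm x y)%g.
Proof.
move=> xy xI yI; apply/permP => i; rewrite permM !(shuffleE _ i).
rewrite -(nth_map i i) ?size_shuffle_seq // map_cat /shuffle_seq.
have eC : ~: (tperm x y @: I) = tperm x y @: (~: I).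
  apply/setP => z; rewrite -[z](tpermK x y) in_setC.
  by rewrite !mem_imset ?in_setC //; apply: perm_inj.
by rewrite eC !enum_imset_tperm ?inE ?(negPf xI) ?yI ?andbF.
Qed.

Lemma sum_setI_tperm I (x y : 'I_n) : y = x.+1 :> nat -> x \notin I -> y \in I ->
  (\sum_(i in I) i.+1 = (\sum_(i in tperm x y @: I) i.+1).+1)%N.
Proof.
move=> xy xI yI; rewrite (big_setD1 y) //=.
have -> : tperm x y @: I = x |: (I :\ y).
  apply/setP => z; rewrite -[z](tpermK x y) mem_imset; last exact: perm_inj.
  move: (tperm x y z) => {}z; rewrite !inE.
  case: tpermP => [->|->|/eqP zx /eqP zy]; rewrite ?eqxx ?yI ?(negPf xI) //=.
    by rewrite orbF; apply/esym/negbTE; rewrite -val_eqE /= xy; lia.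
  by rewrite (negPf zx) zy.
rewrite big_setU1 /= ?xy ?addSn // !inE negb_and xI orbT //.
Qed.

Lemma initial_segment I : (forall x y : 'I_n, y = x.+1 :> nat -> y \in I -> x \in I) ->
  I = [set i : 'I_n | (i < #|I|)%N].
Proof.
move=> hI.
have dI (y x : 'I_n) : (x <= y)%N -> y \in I -> x \in I.
  move: {2}(y - x)%N (erefl (y - x)%N) => d; elim: d y => [|d IH] y.
    by move=> /eqP; rewrite subn_eq0 => yx xy; have -> : x = y by apply/val_inj => /=; lia.
  move=> e _ yI; have hy : (y.-1 < n)%N by apply: leq_ltn_trans (leq_pred _) (ltn_ord y).
  by apply: (IH (Ordinal hy)) => /=; [lia|lia|apply: (hI (Ordinal hy) y) => //=; lia].
(* The least [c] beyond which [I] is empty will be the cardinality of [I]. *)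
pose P c := [forall i : 'I_n, (c <= i)%N ==> (i \notin I)].
have exP : exists c, P c by exists n; apply/forallP => i; rewrite leqNgt ltn_ord.
case: (ex_minnP exP) => c /forallP Pc minc.
have eI : I = [set i : 'I_n | (i < c)%N].
  apply/setP => i; rewrite inE; apply/idP/idP => [iI|ic].
    by rewrite ltnNge; apply: contraL iI; apply/implyP/Pc.
  apply: contraLR ic => iI; rewrite -leqNgt; apply: minc; apply/forallP => j.
  by apply/implyP => ij; apply: contra iI; apply: dI.
have cn : (c <= n)%N by apply: minc; apply/forallP => i; rewrite leqNgt ltn_ord.
suff cI : #|I| = c by rewrite cI.
rewrite eI -sum1_card; under eq_bigl do rewrite inE.
by rewrite (big_ord_narrow cn) /= sum1_card card_ord.
Qed.

Lemma shuffle_initial p : (p <= n)%N -> shuffle [set i : 'I_n | (i < p)%N] = 1%g.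
Proof.
move=> pn; set I := [set _ | _].
have e : shuffle_seq I = enum [set: 'I_n].
  apply: enum_ord_eq; last first.
    by move=> x; rewrite mem_cat !mem_enum in_setC orbN inE.
  have tr : transitive (relpre (@nat_of_ord n) ltn) by move=> y x z /=; apply: ltn_trans.
  rewrite (sorted_pairwise tr) pairwise_cat -!(sorted_pairwise tr) !sorted_enum_ord !andbT.
  apply/allrelP => x y; rewrite !mem_enum !inE /= => xp yp; lia.
apply/permP => i; rewrite perm1 (shuffleE _ i) e.
have -> : enum [set: 'I_n] = enum 'I_n by apply: eq_enum => x; rewrite inE.
exact: nth_ord_enum.
Qed.

Lemma sum_initial p : (p <= n)%N ->
  (\sum_(i in [set i : 'I_n | (i < p)%N]) i.+1 = (p * p.+1) %/ 2)%N.
Proof.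
move=> pn; under eq_bigl do rewrite inE.
rewrite (big_ord_narrow pn) /=; elim: p {pn} => [|p IH]; first by rewrite big_ord0.
rewrite big_ord_recr /= IH; lia.
Qed.

(** Induction on the sum of the 1-based indices. Replacing some [y] in [I] by [y - 1] outside [I]
    lowers the sum by one and composes the shuffle with a transposition, so both parities flip. If
    no such move exists, [I] is an initial segment, the shuffle is the identity and the exponent is
    twice a triangular number. *)
Lemma odd_shuffle I :
  odd_perm (shuffle I) = odd ((#|I| * #|I|.+1) %/ 2 + \sum_(i in I) i.+1)%N.
Proof.
move: {2}(\sum_(i in I) i.+1)%N (erefl (\sum_(i in I) i.+1)%N) => N.
elim: N I => [|N IH] I eN; last first.
  have [/existsP[x /existsP[y /and3P[/eqP xy xI yI]]]|no] :=
    boolP [exists x : 'I_n, [exists y : 'I_n, [&& val y == x.+1, x \notin I & y \in I]]].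
    have eS := sum_setI_tperm xy xI yI.
    have := IH (tperm x y @: I); rewrite shuffle_tperm // odd_permM odd_tperm.
    rewrite card_imset; last exact: perm_inj.
    have -> : (x != y) = true by rewrite -val_eqE /= xy; lia.
    rewrite eS addnS /= addbT => <-; first by rewrite negbK.
    by move: eN; rewrite eS => -[].
  have /initial_segment eI : forall x y : 'I_n, y = x.+1 :> nat -> y \in I -> x \in I.
    move=> x y xy yI; apply: contraR no => xI; apply/existsP; exists x.
    by apply/existsP; exists y; rewrite xI yI -xy eqxx.
  have cI : (#|I| <= n)%N by rewrite -[n in (_ <= n)%N]card_ord max_card.
  rewrite eI sum_initial // shuffle_initial // odd_perm1 -eI; lia.
(* Each index contributes at least 1, so a zero sum forces [I] to be empty. *)
have -> : I = [set i : 'I_n | (i < 0)%N].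
  apply/setP => i; rewrite inE; apply/negbTE/negP => iI.
  by move: eN; rewrite (big_setD1 i).
rewrite shuffle_initial // odd_perm1 sum_initial // addn0.
suff -> : [set i : 'I_n | (i < 0)%N] = set0 by rewrite cards0.
by apply/setP => i; rewrite !inE.
Qed.

Lemma mem_shuffle I i : (shuffle I i \in I) = (i < #|I|)%N.
Proof.
rewrite (shuffleE _ i) nth_cat -cardE; case: ltnP => ip.
  by rewrite -(mem_enum I) mem_nth -?cardE.
apply/negbTE; rewrite -in_setC -mem_enum mem_nth // -cardE.
by rewrite ltn_subLR // cardsC card_ord.
Qed.
End Shuffle.

Section Laplace.
Variable (R : realType).

Lemma shuffle_lshift p q (I : {set 'I_(p + q)}) (b : 'I_p) : #|I| = p ->
  val (shuffle I (lshift q b)) = nth 0%N [seq val y | y <- enum I] b.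
Proof.
move=> cI; rewrite (shuffleE _ (lshift q b)) nth_cat -cardE cI /= ltn_ord.
by rewrite (nth_map (lshift q b)) // -cardE cI.
Qed.

Lemma shuffle_rshift p q (I : {set 'I_(p + q)}) (b : 'I_q) : #|I| = p ->
  val (shuffle I (rshift p b)) = nth 0%N [seq val y | y <- enum (~: I)] b.
Proof.
move=> cI; rewrite (shuffleE _ (rshift p b)) nth_cat -cardE cI /=.
rewrite ltnNge leq_addr /= addKn (nth_map (rshift p b)) // -cardE.
by rewrite -(ltn_add2l #|I|) cardsC card_ord cI ltn_add2l.
Qed.

Lemma minorE n p (A : 'M[R]_(p, n)) (I : {set 'I_n}) (f : 'I_p -> 'I_n) :
  (forall b, val (f b) = nth 0%N [seq val y | y <- enum I] b) ->
  minor A I = \det (\matrix_(a, b) A a (f b)).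
Proof.
move=> fI; congr (\det _); apply/matrixP => a b; rewrite !mxE.
by rewrite (big_pred1 (f b)) // => x; rewrite -fI val_eqE.
Qed.

Lemma imset_initial_eq p n (I : {set 'I_n}) (s : {perm 'I_n}) :
  (s @: [set i : 'I_n | (i < p)%N] == I) = [forall i : 'I_n, (i < p)%N == (s i \in I)].
Proof.
apply/eqP/forallP => [<- i|h].
  by rewrite mem_imset ?inE //; apply: perm_inj.
apply/setP => x; rewrite -[x](permKV s) mem_imset; last exact: perm_inj.
by rewrite inE (eqP (h _)).
Qed.

(** The product of the two minors is the determinant of a block diagonal matrix with columns
    rearranged by the shuffle. Only permutations sending the first [p] rows exactly onto [I] avoid
    the zero blocks. *)
Lemma det_block_shuffle p q (M : 'M[R]_(p + q)) (I : {set 'I_(p + q)}) : #|I| = p ->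
  (-1) ^+ shuffle I * (\det (\matrix_(a, b) M (lshift q a) (shuffle I (lshift q b)))
     * \det (\matrix_(a, b) M (rshift p a) (shuffle I (rshift p b)))) =
  \sum_(s : 'S_(p + q) | s @: [set i : 'I_(p + q) | (i < p)%N] == I)
     (-1) ^+ s * \prod_i M i (s i).
Proof.
move=> cI; rewrite -(det_lblock _ 0); set N := block_mx _ _ _ _.
have NE i j : N i j = if (i < p)%N == (j < p)%N then M i (shuffle I j) else 0.
  rewrite /N !mxE; case: splitP => a ia; rewrite !mxE; case: splitP => b jb;
    rewrite !mxE //=;
    by congr (M _ (shuffle I _)); apply: val_inj; rewrite /= ?ia ?jb.
(* The reindexing undoes the column rearrangement, and the sign it produces cancels the
   prefactor. *)
rewrite /determinant (reindex_inj (mulIg (shuffle I)^-1)%g) /= mulr_sumr [RHS]big_mkcond /=.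
apply: eq_bigr => s _; rewrite imset_initial_eq mulrA -signr_addb.
rewrite odd_permM odd_permV addbC addbK.
have e i : N i ((s * (shuffle I)^-1)%g i) =
    if (i < p)%N == (s i \in I) then M i (s i) else 0.
  have := mem_shuffle I ((shuffle I)^-1%g (s i)); rewrite cI permKV => ->.
  by rewrite NE permM permKV.
case: forallP => [h|/forallP].
  by congr (_ * _); apply: eq_bigr => i _; rewrite e h.
rewrite negb_forall => /existsP[i hi].
by rewrite (bigD1 i) //= e (negPf hi) mul0r mulr0.
Qed.

(** Permutations are grouped by the set [I] of columns assigned to the rows of [A]; [odd_shuffle]
    turns the sign of the shuffle into the explicit exponent. *)
Lemma laplace_expansion p q (A : 'M[R]_(p, p + q)) (B : 'M[R]_(q, p + q)) :
  \sum_(I : ksub (p + q) p)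
     (-1) ^+ ((p * p.+1) %/ 2 + \sum_(i in val I) (val i).+1)%N
       * minor B (~: val I) * minor A (val I) = \det (col_mx A B).
Proof.
have cL (s : 'S_(p + q)) : #|s @: [set i : 'I_(p + q) | (i < p)%N]| == p.
  rewrite card_imset; last exact: perm_inj.
  rewrite -sum1_card; under eq_bigl do rewrite inE.
  by rewrite (big_ord_narrow (leq_addr q p)) /= sum1_card card_ord.
pose im s : ksub (p + q) p := exist (fun I : {set _} => #|I| == p) _ (cL s).
rewrite /determinant (partition_big im xpredT) //=.
apply: eq_bigr => I _; have /eqP cI := valP I.
rewrite [RHS](eq_bigl (fun s : 'S_(p + q) =>
    s @: [set i : 'I_(p + q) | (i < p)%N] == val I)); last first.
  by move=> s; apply/eqP/eqP => [<- //|e]; apply: val_inj.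
rewrite -det_block_shuffle // -mulrA [minor B _ * _]mulrC.
rewrite (minorE A (fun b => shuffle_lshift b cI)) (minorE B (fun b => shuffle_rshift b cI)).
congr (_ * (_ * _)).
- by rewrite -signr_odd odd_shuffle cI.
- by congr (\det _); apply/matrixP => a b; rewrite [LHS]mxE [RHS]mxE col_mxEu.
- by congr (\det _); apply/matrixP => a b; rewrite [LHS]mxE [RHS]mxE col_mxEd.
Qed.

(** The sizes are linked by equations so that [row_base] matrices, whose row counts are ranks, fit
    without casts. *)
Lemma laplace_rank n d p q (A : 'M[R]_(p, n)) (B : 'M[R]_(q, n)) :
  p = d -> (p + q = n)%N ->
  (\sum_(I : ksub n d)
     (-1) ^+ ((d * d.+1) %/ 2 + \sum_(i in val I) (val i).+1)%N
       * minor B (~: val I) * minor A (val I) == 0) = (\rank (col_mx A B) != n).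
Proof.
move=> pd pqn; subst d; subst n; rewrite laplace_expansion.
by rewrite -[_ == 0]negbK -unitfE -unitmxE -row_full_unit.
Qed.

Lemma adj_hyperplane n d (W X : 'M[R]_n) : \rank W = d -> (n - \rank X)%N = d ->
  (\sum_(I : ksub n d) adj_coef X I * plucker W (val I) == 0) =
  (\rank (W :&: X)%MS != 0)%N.
Proof.
move=> rW rX; have rn := rank_leq_row X; have rWX : (\rank W + \rank X = n)%N by lia.
rewrite (laplace_rank (row_base W) (row_base X) rW rWX); congr (~~ _).
have -> : \rank (col_mx (row_base W) (row_base X)) = \rank (W + X)%MS.
  by rewrite -addsmxE (adds_eqmx (eq_row_base W) (eq_row_base X)).
have := mxrank_sum_cap W X; rewrite rWX => e; apply/eqP/eqP; lia.
Qed.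

End Laplace.

(** * Maximal chains *)

Section Jumps.
Local Open Scope nat_scope.

(** Counting steps up from 0 bounds [f j] below, counting them down from [r] bounds it above, and
    the bounds agree. *)
Lemma strict_chain_exact (f : nat -> nat) r :
  (forall j, j < r -> f j < f j.+1) -> f r = f 0 + r ->
  forall j, j <= r -> f j = f 0 + j.
Proof.
move=> incf fr.
have lo j : j <= r -> f 0 + j <= f j.
  by elim: j => [|j IH] jr; [rewrite addn0 | have := IH (ltnW jr); have := incf j jr; lia].
have up d : d <= r -> f (r - d) + d <= f r.
  elim: d => [|d IH] dr; first by rewrite subn0 addn0.
  have := IH (ltnW dr); have := incf (r - d.+1).
  have -> : (r - d.+1).+1 = r - d by lia.
  by move=> /(_ ltac:(lia)); lia.
move=> j jr; have := lo j jr; have := up (r - j) (leq_subr _ _).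
have -> : r - (r - j) = j by lia.
lia.
Qed.

Definition jumps r (f : nat -> nat) : {set 'I_r} := [set j : 'I_r | f j < f j.+1].

Lemma sum_jumps (f : nat -> nat) r :
  (forall j, j < r -> f j <= f j.+1 <= (f j).+1) ->
  forall l, l <= r -> f l = f 0 + \sum_(j < l) (f j < f j.+1).
Proof.
move=> hf; elim=> [|l IH] lr; first by rewrite big_ord0 addn0.
rewrite big_ord_recr /= addnA -IH ?(ltnW lr) //.
by have := hf l lr; case: ltnP => /=; lia.
Qed.

Lemma card_jumps (f : nat -> nat) r :
  (forall j, j < r -> f j <= f j.+1 <= (f j).+1) -> #|jumps r f| = f r - f 0.
Proof.
move=> hf; rewrite (sum_jumps hf (leqnn r)) addKn -sum1_card big_mkcond /=.
by apply: eq_bigr => j _; rewrite inE; case: ltnP.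
Qed.

(** With steps of 0 or 1 the number of jumps is the total increase, so a set of jumps of that size
    contains them all. *)
Lemma jumps_determine (f g : nat -> nat) r (s : {set 'I_r}) :
  (forall j, j < r -> f j <= f j.+1 <= (f j).+1) ->
  (forall j, j < r -> g j <= g j.+1 <= (g j).+1) ->
  f 0 = g 0 -> f r = g r -> #|s| = f r - f 0 ->
  s \subset jumps r f -> s \subset jumps r g ->
  forall l, l <= r -> f l = g l.
Proof.
move=> hf hg f0 fr cs sf sg l lr.
have ef : s = jumps r f by apply/eqP; rewrite eqEcard sf card_jumps //= cs leqnn.
have eg : s = jumps r g by apply/eqP; rewrite eqEcard sg card_jumps //= cs f0 fr leqnn.
rewrite (sum_jumps hf lr) (sum_jumps hg lr) f0; congr (_ + _).
apply: eq_bigr => j _; have /setP/(_ (widen_ord lr j)) : jumps r f = jumps r g by rewrite -ef.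
by rewrite !inE /= => ->.
Qed.
End Jumps.

Section Chains.
Variables (R : realType) (n m : nat) (alpha : 'I_m -> 'rV[R]_n).
Implicit Types (J : {set 'I_m}) (U A B : 'M[R]_n) (F : nat -> 'M[R]_n).

Lemma mxrank_cap_step U A B : (A <= B)%MS ->
  (\rank (U :&: B)%MS + \rank A <= \rank (U :&: A)%MS + \rank B)%N.
Proof.
move=> sAB; rewrite -mxrank_sum_cap addnC leq_add //; apply: mxrankS.
  by rewrite -capmxA capmxS // capmxSr.
by rewrite addsmx_sub capmxSr.
Qed.

Lemma mxrank_max_chain F : max_chain alpha F ->
  forall j, (j <= rkT alpha)%N -> \rank (F j) = (\rank (Tcap alpha) + j)%N.
Proof.
move=> [_ [/eqmxP F0 [/eqmxP Fr ltF]]] j jr; rewrite -F0.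
apply: (strict_chain_exact (f := fun j => \rank (F j)) (r := rkT alpha)) => //.
  by move=> l lr; apply/rank_ltmx/ltF.
by rewrite Fr F0 mxrank1 subnKC ?rank_leq_row.
Qed.

Lemma max_chain_cap_step F U : max_chain alpha F -> forall j, (j < rkT alpha)%N ->
  (\rank (U :&: F j) <= \rank (U :&: F j.+1) <= (\rank (U :&: F j)).+1)%N.
Proof.
move=> mF j jr; have sF : (F j <= F j.+1)%MS by case: mF => _ [_ [_ /(_ j jr)/ltmxW]].
apply/andP; split; first by apply: mxrankS; apply: capmxS.
have := mxrank_cap_step U sF; rewrite (mxrank_max_chain mF jr) (mxrank_max_chain mF (ltnW jr)).
lia.
Qed.

Lemma max_chain_cap_ends F U : max_chain alpha F ->
  \rank (U :&: F 0%N)%MS = \rank (U :&: Tcap alpha)%MS /\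
  \rank (U :&: F (rkT alpha))%MS = \rank U.
Proof.
case=> _ [/eqmxP F0 [/eqmxP Fr _]].
rewrite (cap_eqmx (eqmx_refl U) F0) (cap_eqmx (eqmx_refl U) Fr); split=> //.
by rewrite capmx1.
Qed.

(** Cutting by the hyperplanes one at a time, those of [J] first, gives flats [G t] passing through
    [flatJ alpha J], with dimension dropping by at most 1 at each cut. Dropping repetitions leaves a
    maximal chain. *)
Lemma max_chain_through J : exists2 F, max_chain alpha F &
  exists2 l, (l <= rkT alpha)%N & (F l :=: flatJ alpha J)%MS.
Proof.
pose e := enum J ++ enum (~: J).
pose G t := flatJ alpha [set i in take t e].
pose g t := \rank (G t); set tT := \rank (Tcap alpha).
have sG t u : (t <= u)%N -> (G u <= G t)%MS.
  move=> tu; apply: flatJS; apply/subsetP => i; rewrite !inE.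
  by rewrite -(subnKC tu) takeD mem_cat => ->.
have G0 : (G 0%N :=: 1%:M)%MS.
  apply/eqmxP; rewrite submx1 /=; apply/sub_flatJP => i.
  by rewrite inE take0.
have GJ : G #|J| = flatJ alpha J.
  congr (flatJ alpha _); apply/setP => i.
  by rewrite inE cardE take_size_cat // mem_enum.
have Gm : G (size e) = Tcap alpha.
  congr (flatJ alpha _); apply/setP => i.
  by rewrite !inE take_size mem_cat !mem_enum in_setC orbN.
have gS t : (g t <= (g t.+1).+1)%N.
  case: (ltnP t (size e)) => te; last first.
    by rewrite /g /G !take_oversize // leqW.
  have x0 : 'I_m by move: te; case: (e) => // x.
  suff -> : g t.+1 = \rank (flatJ alpha (nth x0 e t |: [set i in take t e])).
    exact: mxrank_flatJU1.
  congr (\rank (flatJ alpha _)); apply/setP => i.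
  by rewrite !inE (take_nth x0 te) mem_rcons in_cons.
have g0 : g 0%N = n by rewrite /g G0 mxrank1.
have gm : g (size e) = tT by rewrite /g Gm.
have ex j : exists t, (g t <= tT + j)%N by exists (size e); rewrite gm leq_addr.
(* [tau j] is the first time the dimension is at most [tT + j]; as no cut skips a dimension,
   equality holds there when [j <= rkT alpha]. *)
pose tau j := ex_minn (ex j); pose F j := G (tau j).
have tn : (tT <= n)%N by apply: rank_leq_row.
have rF j : (j <= rkT alpha)%N -> \rank (F j) = (tT + j)%N.
  rewrite /rkT -/tT => jr; rewrite /F /tau; case: ex_minnP => -[|t] gt mint.
    by rewrite -/(g 0%N); lia.
  have : ~~ (g t <= tT + j)%N by apply/negP => /mint; rewrite ltnn.
  by rewrite -/(g t.+1); have := gS t; lia.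
have tauS j l : (j <= l)%N -> (tau l <= tau j)%N.
  move=> jl; rewrite /tau; case: (ex_minnP (ex j)) => t gt _.
  by case: ex_minnP => u _; apply; apply: leq_trans gt _; rewrite leq_add2l.
exists F; last first.
  have gJ : (tT <= g #|J|)%N by rewrite /g GJ; apply/mxrankS/sub_Tcap_flatJ.
  have gJn : (g #|J| <= n)%N by apply: rank_leq_row.
  have lr : (g #|J| - tT <= rkT alpha)%N by rewrite /rkT leq_sub2r.
  exists (g #|J| - tT)%N => //; apply/eqmx_sym/eqmxP.
  (* This dimension is first reached no later than time [#|J|]; equality of ranks then turns the
     inclusion into equality. *)
  have s : (flatJ alpha J <= F (g #|J| - tT)%N)%MS.
    rewrite -GJ; apply: sG; rewrite /tau; case: ex_minnP => t _; apply.
    by rewrite subnKC.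
  rewrite -(geq_leqif (mxrank_leqif_eq s)) rF // subnKC //.
  by rewrite /g GJ.
split; first by move=> j _; exists [set i in take (tau j) e]; rewrite submx_refl.
split.
  apply/eqmxP/eqmx_sym/eqmxP.
  have s : (Tcap alpha <= F 0%N)%MS by apply: sub_Tcap_flatJ.
  by rewrite -(geq_leqif (mxrank_leqif_eq s)) rF // addn0.
split.
  by rewrite -(geq_leqif (mxrank_leqif_eq (submx1 _))) rF // mxrank1 subnKC.
move=> j jr; rewrite ltmxErank rF ?(ltnW jr) // rF // addnS ltnSn andbT.
by apply/sG/tauS.
Qed.
End Chains.

(** * Adjoint hyperplanes *)

Section Adjoint.
Variables (R : realType) (n m : nat) (alpha : 'I_m -> 'rV[R]_n).
Implicit Types (J : {set 'I_m}) (U : 'M[R]_n).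

Definition adj_form d J (x : ksub n d -> R) : R :=
  \sum_(I : ksub n d) adj_coef (flatJ alpha J) I * x I.

(** If [JJ] records all hyperplanes through [x], every intersection containing [x] contains the one
    cut out by [JJ], so none is properly smaller. *)
Lemma in_relint_intro d (JJ : {set {set 'I_m}}) (x : ksub n d -> R) :
  (forall J, (n - \rank (flatJ alpha J))%N = d -> (J \in JJ) = (adj_form J x == 0)) ->
  in_relint alpha JJ x.
Proof.
move=> h; split=> [J JJJ rJ|JJ' _ [y [yJJ yJJ']] xJJ'].
  by apply/eqP; rewrite -/(adj_form _ _) -h.
apply: yJJ' => J J' rJ; apply: yJJ => //; rewrite h //; apply/eqP; exact: xJJ'.
Qed.

(* If [x2] were on a further hyperplane avoided by [x1], adding that hyperplane
   to [JJ] would cut out a proper subspace, with [x1] as witness. *)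
Lemma in_relint_elim d (JJ : {set {set 'I_m}}) (x1 x2 : ksub n d -> R) J :
  in_relint alpha JJ x1 -> in_relint alpha JJ x2 ->
  (n - \rank (flatJ alpha J))%N = d -> adj_form J x2 = 0 -> adj_form J x1 = 0.
Proof.
move=> [z1 _] [z2 i2] rJ x2J; apply/eqP/negP => /negP x1J.
apply: (i2 (J |: JJ)).
- by move=> y hy K KJJ; apply: hy; rewrite in_setU1 KJJ orbT.
- exists x1; split=> // h; case/eqP: x1J; apply: h => //; exact: setU11.
by move=> K; rewrite in_setU1 => /orP[/eqP->|] //; apply: z2.
Qed.

Definition adj_point d U : ksub n d -> R :=
  fun I => plucker (U :&: (orthc U + orthc (Tcap alpha)))%MS (val I).

Lemma adj_form_point U J (i : nat) : \rank (U :&: Tcap alpha)%MS = i ->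
  (n - \rank (flatJ alpha J))%N = (\rank U - i)%N ->
  (adj_form J (@adj_point (\rank U - i) U) == 0) = (\rank (U :&: flatJ alpha J)%MS != i).
Proof.
move=> ri rJ; rewrite /adj_form adj_hyperplane ?mxrank_orthc_in ?ri //.
rewrite (mxrank_cap_split U (sub_Tcap_flatJ alpha J)) ri.
by rewrite -[X in _ = (_ != X)]addn0 eqn_add2l.
Qed.

Lemma amatroid_rank_le_corank U J :
  (amatroid_rank alpha U J <= n - \rank (flatJ alpha J))%N.
Proof.
rewrite amatroid_rankE; have := mxrank_sum_cap U (flatJ alpha J).
have := rank_leq_row (U + flatJ alpha J)%MS; lia.
Qed.

(** The flat of a basis [B] for [U1] has corank at least the matroid rank of [B] and at most [#|B|],
    both equal to [\rank U1 - i]. The hypothesis thus applies to it and makes [B] independent for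
    [U2]. *)
Lemma amatroid_rank_le_of_bases U1 U2 (i : nat) : \rank U1 = \rank U2 ->
  \rank (U1 :&: Tcap alpha)%MS = i ->
  (forall J, (n - \rank (flatJ alpha J))%N = (\rank U1 - i)%N ->
     \rank (U1 :&: flatJ alpha J)%MS = i -> \rank (U2 :&: flatJ alpha J)%MS = i) ->
  forall J, (amatroid_rank alpha U1 J <= amatroid_rank alpha U2 J)%N.
Proof.
move=> eU ri h; apply: (@rksum_bases _ _ _ _ (beta alpha U1) (beta alpha U2)) => B.
have rkE U K : rksum (beta alpha U) K = amatroid_rank alpha U K by [].
rewrite !rkE => fB; rewrite [amatroid_rank _ _ setT]amatroid_rankE -/(Tcap alpha) ri => bB.
have cB : (n - \rank (flatJ alpha B))%N = (\rank U1 - i)%N.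
  apply/eqP; rewrite eqn_leq -{2}bB amatroid_rank_le_corank andbT corank_flatJ.
  by rewrite -bB fB rksum_card.
have iB : \rank (U1 :&: flatJ alpha B)%MS = i.
  have := bB; rewrite amatroid_rankE.
  have := mxrankS (capmxSl U1 (flatJ alpha B)); have := mxrankS (capmxSl U1 (Tcap alpha)).
  rewrite ri; lia.
by rewrite -fB bB amatroid_rankE (h B cB iB) eU.
Qed.
End Adjoint.

(** * Comparison of the three decompositions *)

Section Strata.
Variables (R : realType) (n m : nat) (alpha : 'I_m -> 'rV[R]_n).
Variables (U1 U2 : 'M[R]_n).
Hypothesis eqU : \rank U1 = \rank U2.

Lemma amatroid_rank_eqP :
  (forall J, amatroid_rank alpha U1 J = amatroid_rank alpha U2 J) <->
  (forall J, \rank (U1 :&: flatJ alpha J)%MS = \rank (U2 :&: flatJ alpha J)%MS).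
Proof.
split=> h J; last by rewrite !amatroid_rankE eqU h.
have := h J; rewrite !amatroid_rankE eqU.
have := mxrankS (capmxSl U1 (flatJ alpha J)).
have := mxrankS (capmxSl U2 (flatJ alpha J)); rewrite eqU; lia.
Qed.

Lemma same_adj_stratumP :
  (forall J, amatroid_rank alpha U1 J = amatroid_rank alpha U2 J) <->
  (exists (i : nat) (JJ : {set {set 'I_m}}), (i <= \rank U1)%N /\
     adj_stratum alpha (\rank U1) i JJ U1 /\ adj_stratum alpha (\rank U1) i JJ U2).
Proof.
rewrite amatroid_rank_eqP; split=> [h|[i [JJ [_ [[_ [r1 s1]] [_ [r2 s2]]]]]]].
  pose i := \rank (U1 :&: Tcap alpha)%MS.
  have i2 : \rank (U2 :&: Tcap alpha)%MS = i by rewrite -h.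
  (* In corank [\rank U1 - i] these [J] index the hyperplanes through the adjoint point of [U1], and
     by [h] also those through that of [U2]. *)
  exists i, [set J | \rank (U1 :&: flatJ alpha J)%MS != i].
  split; first exact/mxrankS/capmxSl.
  split; split=> //; split=> //; apply: in_relint_intro => J rJ; rewrite inE.
    by rewrite adj_form_point.
  by rewrite h; move: rJ; rewrite eqU => rJ; rewrite adj_form_point.
apply/amatroid_rank_eqP => J; apply/eqP; rewrite eqn_leq; apply/andP; split.
  apply: (amatroid_rank_le_of_bases eqU r1) => {}J rJ i1.
  (* Contrapositive: a hyperplane through the point of [U2] also passes through that of [U1], both
     lying in the same relative interior. *)
  apply/eqP; apply: contra_eqT i1 => i2; rewrite -adj_form_point //.
  apply/eqP; apply: (in_relint_elim s1 s2 rJ); apply/eqP.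
  by move: rJ; rewrite eqU => rJ; rewrite adj_form_point.
apply: (amatroid_rank_le_of_bases (esym eqU) r2) => {}J; rewrite -eqU => rJ i2.
apply/eqP; apply: contra_eqT i2 => i1; have rJ2 := rJ; rewrite eqU in rJ2.
rewrite -adj_form_point //; rewrite eqU in s1 s2.
apply/eqP; apply: (in_relint_elim s2 s1 rJ2); apply/eqP.
by rewrite -eqU adj_form_point.
Qed.

Lemma same_schub_stratumP :
  (forall J, amatroid_rank alpha U1 J = amatroid_rank alpha U2 J) <->
  (exists (i : nat) (sigma : (nat -> 'M[R]_n) -> {set 'I_(rkT alpha)}),
     (i <= \rank U1)%N /\ schub_stratum alpha (\rank U1) i sigma U1 /\
     schub_stratum alpha (\rank U1) i sigma U2).
Proof.
rewrite amatroid_rank_eqP; split=> [h|[i [sigma [_ [[_ [r1 s1]] [_ [r2 s2]]]]]] J].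
  exists (\rank (U1 :&: Tcap alpha)%MS).
  (* The symbol assigns to each chain all the jumps of [U1]; their number is the total increase,
     [\rank U1 - i]. *)
  exists (fun F => jumps (rkT alpha) (fun j => \rank (U1 :&: F j)%MS)).
  split; first exact/mxrankS/capmxSl.
  have cj F : max_chain alpha F ->
      #|jumps (rkT alpha) (fun j => \rank (U1 :&: F j)%MS)| =
      (\rank U1 - \rank (U1 :&: Tcap alpha)%MS)%N.
    move=> mF; have [<- <-] := max_chain_cap_ends U1 mF.
    exact/card_jumps/max_chain_cap_step.
  have hF F j : max_chain alpha F -> (j <= rkT alpha)%N ->
      \rank (U1 :&: F j)%MS = \rank (U2 :&: F j)%MS.
    case=> latF _ /latF [J /eqmxP FJ].
    by rewrite (cap_eqmx (eqmx_refl U1) FJ) (cap_eqmx (eqmx_refl U2) FJ).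
  split; split=> //; split=> [|F mF].
  - by [].
  - by split=> //; split=> //; split=> [|j]; [exact: cj | rewrite inE].
  - by rewrite -h.
  split=> //; split; first by rewrite -h.
  split=> [|j]; first exact: cj.
  by rewrite inE !hF // ltnW.
have [F mF [l lr Fl]] := max_chain_through alpha J.
rewrite -(cap_eqmx (eqmx_refl U1) Fl) -(cap_eqmx (eqmx_refl U2) Fl).
have [_ [_ [cs j1]]] := s1 F mF; have [_ [_ [_ j2]]] := s2 F mF.
have [z1 e1] := max_chain_cap_ends U1 mF; have [z2 e2] := max_chain_cap_ends U2 mF.
apply: (@jumps_determine (fun j => \rank (U1 :&: F j)%MS) (fun j => \rank (U2 :&: F j)%MS)
  (rkT alpha) (sigma F)) => //.
- exact: max_chain_cap_step.
- exact: max_chain_cap_step.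
- by rewrite z1 z2 r1.
- by rewrite e1 e2.
- by rewrite e1 z1 r1.
- by apply/subsetP => j /j1; rewrite inE.
- by apply/subsetP => j /j2; rewrite inE.
Qed.
End Strata.

Theorem theorem1p2 (R : realType) (n m : nat) (alpha : 'I_m -> 'rV[R]_n)
    (halpha : forall i, alpha i != 0) (k : nat) (hk : (k <= n)%N)
    (U1 U2 : 'M[R]_n) (hU1 : \rank U1 = k) (hU2 : \rank U2 = k) :
  ((forall J : {set 'I_m}, amatroid_rank alpha U1 J = amatroid_rank alpha U2 J)
     <->
   (exists (i : nat) (JJ : {set {set 'I_m}}),
      (i <= k)%N /\ adj_stratum alpha k i JJ U1 /\ adj_stratum alpha k i JJ U2))
  /\
  ((forall J : {set 'I_m}, amatroid_rank alpha U1 J = amatroid_rank alpha U2 J)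
     <->
   (exists (i : nat) (sigma : (nat -> 'M[R]_n) -> {set 'I_(rkT alpha)}),
      (i <= k)%N /\ schub_stratum alpha k i sigma U1 /\ schub_stratum alpha k i sigma U2)).
Proof.
have eqU : \rank U1 = \rank U2 by rewrite hU1 hU2.
rewrite -{hk hU2}hU1; split.
  exact: same_adj_stratumP.
exact: same_schub_stratumP.
Qed.
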